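(* Let $\mathbb F_q$ be a finite field and $\mathbb F_q^{\oplus\omega}$ the vector space of countably infinite dimension over $\mathbb F_q$. The groups $\mathrm{GL}(\mathbb F_q^{\oplus\omega})$, $\mathrm O(\mathbb F_q^{\oplus\omega})$ and $\mathrm{Sp}(\mathbb F_q^{\oplus\omega})$ do not admit non-singular mixed identities (in any finite number $r$ of variables).
   Context: $\mathrm{GL}(\mathbb F_q^{\oplus\omega})$ is the group of all invertible linear maps of $\mathbb F_q^{\oplus\omega}$; $\mathrm O(\mathbb F_q^{\oplus\omega})$ and $\mathrm{Sp}(\mathbb F_q^{\oplus\omega})$ are the subgroups of those invertible linear maps preserving a fixed non-degenerate symmetric, respectively non-degenerate alternating, bilinear form $f\colon\mathbb F_q^{\oplus\omega}\times\mathbb F_q^{\oplus\omega}\to\mathbb F_q$. For a group $G$ and the free group $\mathbf F_r=\langle x_1,\dots,x_r\rangle$, a word with constants in $G$ is an element $w\in G\ast\mathbf F_r$. For $g_1,\dots,g_r\in G$, $w(g_1,\dots,g_r)\in G$ denotes the image of $w$ under the homomorphism $G\ast\mathbf F_r\to G$ that is the identity on $G$ and sends $x_i\mapsto g_i$. The word $w$ is a mixed identity for $G$ if $w\neq1$ in $G\ast\mathbf F_r$ and $w(g_1,\dots,g_r)=1_G$ for all $g_1,\dots,g_r\in G$. Let $\epsilon\colon G\ast\mathbf F_r\to\mathbf F_r$ be the homomorphism that sends every element of $G$ to $1$ and is the identity on $\mathbf F_r$; $w$ is singular if $\epsilon(w)=1$ and non-singular otherwise. *)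

(* Defs.v *)
(* MathComp; boolp supplies the classical choice used for quotients and for
   function types. *)
From HB Require Import structures.
From mathcomp Require Import all_boot all_order all_algebra.
From mathcomp Require Import boolp.

Set Implicit Arguments.
Unset Strict Implicit.
Unset Printing Implicit Defensive.

Import GRing.Theory.

Local Open Scope quotient_scope.

(* The group presented by generators X and relators u = v for R u v, as words
   modulo the congruence generated by free cancellation and R.  The letter
   (x, false) stands for x and (x, true) for its inverse. *)
Section PresentedGroup.
Variables (X : choiceType) (R : seq (X * bool) -> seq (X * bool) -> Prop).
Local Notation word := (seq (X * bool)).

Inductive word_cong : word -> word -> Prop :=
| cong_refl u : word_cong u u
| cong_sym u v : word_cong u v -> word_cong v u
| cong_trans u v w : word_cong u v -> word_cong v w -> word_cong u w
| cong_cat u u' v v' :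
    word_cong u u' -> word_cong v v' -> word_cong (u ++ v) (u' ++ v')
| cong_cancel x b : word_cong [:: (x, b); (x, ~~ b)] [::]
| cong_rel u v : R u v -> word_cong u v.

Definition word_congb : rel word := fun u v => `[< word_cong u v >].

Fact word_congb_refl : reflexive word_congb.
Proof. by move=> u; apply/asboolP; apply: cong_refl. Qed.

Fact word_congb_sym : symmetric word_congb.
Proof.
by move=> u v; apply/asboolP/asboolP; apply: cong_sym.
Qed.

Fact word_congb_trans : transitive word_congb.
Proof.
move=> v u w /asboolP uv /asboolP vw; apply/asboolP.
exact: cong_trans uv vw.
Qed.

Canonical word_congb_equiv :=
  EquivRel word_congb word_congb_refl word_congb_sym word_congb_trans.

Definition presented := {eq_quot word_congb_equiv}.
HB.instance Definition _ := Choice.on presented.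

Definition word_class (u : word) : presented := \pi_{eq_quot word_congb_equiv} u.
Definition word_repr (a : presented) : word := repr (a : {eq_quot word_congb_equiv}).

Lemma word_reprK : cancel word_repr word_class.
Proof. by move=> a; rewrite /word_class /word_repr reprK. Qed.

Lemma word_classP u v : word_class u = word_class v <-> word_cong u v.
Proof.
by split=> [/eqmodP/asboolP | uv]; last by apply/eqmodP/asboolP.
Qed.

Lemma word_repr_cong u : word_cong (word_repr (word_class u)) u.
Proof. by apply/word_classP; rewrite word_reprK. Qed.

Definition word_inv (u : word) : word := rev [seq (l.1, ~~ l.2) | l <- u].

Lemma word_invK : involutive word_inv.
Proof.
move=> u; rewrite /word_inv map_rev revK -map_comp -[RHS]map_id.
by apply: eq_map => -[x b] /=; rewrite negbK.
Qed.

Lemma word_invr u : word_cong (u ++ word_inv u) [::].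
Proof.
elim: u => [|[x b] u IHu]; first exact: cong_refl.
have -> : word_inv ((x, b) :: u) = word_inv u ++ [:: (x, ~~ b)].
  by rewrite /word_inv /= rev_cons cats1.
rewrite catA cat_cons -cat1s -!catA catA.
apply: (cong_trans _ (cong_cancel x b)).
rewrite -[X in word_cong _ X]/([:: (x, b)] ++ ([::] ++ [:: (x, ~~ b)])) -catA.
apply: cong_cat; first exact: cong_refl.
by rewrite catA; apply: cong_cat => //; apply: cong_refl.
Qed.

Lemma word_invl u : word_cong (word_inv u ++ u) [::].
Proof. by rewrite -{2}[u]word_invK; apply: word_invr. Qed.

Definition presented_mul (a b : presented) : presented :=
  word_class (word_repr a ++ word_repr b).
Definition presented_one : presented := word_class [::].
Definition presented_inv (a : presented) : presented :=
  word_class (word_inv (word_repr a)).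

Lemma presented_mulE u v :
  presented_mul (word_class u) (word_class v) = word_class (u ++ v).
Proof. by apply/word_classP; apply: cong_cat; apply: word_repr_cong. Qed.

Fact presented_mulA : associative presented_mul.
Proof.
move=> a b c; rewrite -(word_reprK a) -(word_reprK b) -(word_reprK c).
by rewrite !presented_mulE catA.
Qed.

Fact presented_mul1 : left_id presented_one presented_mul.
Proof. by move=> a; rewrite -(word_reprK a) presented_mulE. Qed.

Fact presented_mulr1 : right_id presented_one presented_mul.
Proof. by move=> a; rewrite -(word_reprK a) presented_mulE cats0. Qed.

Fact presented_mulV : left_inverse presented_one presented_inv presented_mul.
Proof.
move=> a; rewrite -{2}(word_reprK a) presented_mulE.
by apply/word_classP; apply: word_invl.
Qed.

Fact presented_mulrV : right_inverse presented_one presented_inv presented_mul.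
Proof.
move=> a; rewrite -{1}(word_reprK a) presented_mulE.
by apply/word_classP; apply: word_invr.
Qed.

HB.instance Definition _ := isGroup.Build presented
  presented_mulA presented_mul1 presented_mulr1 presented_mulV presented_mulrV.

Definition presented_gen (x : X) : presented := word_class [:: (x, false)].

Section Lift.
Variables (K : groupType) (phi : X -> K).

Definition word_eval (u : word) : K :=
  foldr (fun l k => (if l.2 then (phi l.1)^-1 else phi l.1) * k)%g 1%g u.

(* This is the homomorphism induced by phi when phi satisfies R; see
   presented_liftM, presented_lift_gen and presented_lift_unique. *)
Definition presented_lift (a : presented) : K := word_eval (word_repr a).

Lemma word_eval_cat u v : word_eval (u ++ v) = (word_eval u * word_eval v)%g.
Proof. by elim: u => [|l u IHu] /=; rewrite ?mul1g // IHu mulgA. Qed.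

Hypothesis phiR : forall u v, R u v -> word_eval u = word_eval v.

Lemma word_eval_cong u v : word_cong u v -> word_eval u = word_eval v.
Proof.
elim=> {u v} //= [u v w _ -> _ -> // | u u' v v' _ Eu _ Ev | x b].
  by rewrite !word_eval_cat Eu Ev.
by case: b; rewrite mulg1 ?mulVg ?mulgV.
Qed.

Lemma presented_liftE u : presented_lift (word_class u) = word_eval u.
Proof. exact/word_eval_cong/word_repr_cong. Qed.

Lemma presented_liftM : {morph presented_lift : a b / (a * b)%g}.
Proof.
move=> a b; rewrite -(word_reprK a) -(word_reprK b) [(_ * _)%g]presented_mulE.
by rewrite !presented_liftE word_eval_cat.
Qed.

Lemma presented_lift1 : presented_lift 1%g = 1%g.
Proof. by rewrite [1%g in LHS]/(word_class [::]) presented_liftE. Qed.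

Lemma presented_lift_gen x : presented_lift (presented_gen x) = phi x.
Proof. by rewrite presented_liftE /= mulg1. Qed.

Lemma presented_lift_unique (h : presented -> K) :
    {morph h : a b / (a * b)%g} -> (forall x, h (presented_gen x) = phi x) ->
  h =1 presented_lift.
Proof.
move=> hM hx a; rewrite -(word_reprK a) presented_liftE.
have h1 : h (word_class [::]) = 1%g.
  by apply: (mulgI (h (word_class [::]))); rewrite mulg1 -hM mulg1.
elim: (word_repr a) => //= -[x b] u IHu.
rewrite -cat1s -presented_mulE [LHS]hM IHu; congr (_ * _)%g.
case: b => /=; last exact: hx.
apply: (mulgI (phi x)); rewrite mulgV -(hx x) -hM -h1; congr h.
by rewrite [LHS]presented_mulE; apply/word_classP/cong_cancel.
Qed.

End Lift.
End PresentedGroup.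

Section FreeGroup.
Variable r : nat.

Definition free_group := @presented 'I_r (fun _ _ => False).
HB.instance Definition _ := Group.on free_group.

Definition free_gen (i : 'I_r) : free_group := presented_gen _ i.

Definition free_lift (K : groupType) (g : 'I_r -> K) : free_group -> K :=
  presented_lift g.

Lemma free_liftM (K : groupType) (g : 'I_r -> K) :
  {morph free_lift g : a b / (a * b)%g}.
Proof. exact: presented_liftM. Qed.

Lemma free_lift_gen (K : groupType) (g : 'I_r -> K) i :
  free_lift g (free_gen i) = g i.
Proof. exact: presented_lift_gen. Qed.

End FreeGroup.

(* The free product, generated by the elements of G and H subject to the two
   multiplication tables. *)
Section FreeProduct.
Variables G H : groupType.

Inductive free_prod_rel : seq ((G + H) * bool) -> seq ((G + H) * bool) -> Prop :=
| free_prod_rell (a b : G) :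
    free_prod_rel [:: (inl a, false); (inl b, false)] [:: (inl (a * b)%g, false)]
| free_prod_relr (a b : H) :
    free_prod_rel [:: (inr a, false); (inr b, false)] [:: (inr (a * b)%g, false)].

Definition free_prod := presented free_prod_rel.
HB.instance Definition _ := Group.on free_prod.

Definition free_prod_inl (a : G) : free_prod := presented_gen _ (inl a).
Definition free_prod_inr (b : H) : free_prod := presented_gen _ (inr b).

Lemma free_prod_inlM : {morph free_prod_inl : a b / (a * b)%g}.
Proof.
move=> a b; rewrite [RHS]presented_mulE; apply/word_classP/cong_sym.
exact/cong_rel/free_prod_rell.
Qed.

Lemma free_prod_inrM : {morph free_prod_inr : a b / (a * b)%g}.
Proof.
move=> a b; rewrite [RHS]presented_mulE; apply/word_classP/cong_sym.
exact/cong_rel/free_prod_relr.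
Qed.

(* For homomorphisms p and s, the homomorphism they induce on the free
   product. *)
Definition free_prod_lift (K : groupType) (p : G -> K) (s : H -> K) :
    free_prod -> K :=
  presented_lift (fun x : G + H => match x with inl a => p a | inr b => s b end).

Section Universal.
Variables (K : groupType) (p : G -> K) (s : H -> K).
Hypotheses (pM : {morph p : a b / (a * b)%g}) (sM : {morph s : a b / (a * b)%g}).

Let liftR (u v : seq ((G + H) * bool)) : free_prod_rel u v ->
  word_eval (fun x => match x with inl a => p a | inr b => s b end) u =
  word_eval (fun x => match x with inl a => p a | inr b => s b end) v.
Proof. by case=> a b /=; rewrite !mulg1 ?pM ?sM. Qed.

Lemma free_prod_liftM : {morph free_prod_lift p s : a b / (a * b)%g}.
Proof. exact: presented_liftM liftR. Qed.

Lemma free_prod_lift_inl a : free_prod_lift p s (free_prod_inl a) = p a.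
Proof. exact: (presented_lift_gen liftR (inl a)). Qed.

Lemma free_prod_lift_inr b : free_prod_lift p s (free_prod_inr b) = s b.
Proof. exact: (presented_lift_gen liftR (inr b)). Qed.

Lemma free_prod_lift_unique (h : free_prod -> K) :
    {morph h : a b / (a * b)%g} -> (forall a, h (free_prod_inl a) = p a) ->
    (forall b, h (free_prod_inr b) = s b) ->
  h =1 free_prod_lift p s.
Proof. by move=> hM hl hr; apply: (presented_lift_unique liftR hM) => -[]. Qed.

End Universal.
End FreeProduct.

Section MixedIdentities.
Variables (G : groupType) (r : nat).

Definition word_with_constants := free_prod G (free_group r).
HB.instance Definition _ := Group.on word_with_constants.

Definition substitute (g : 'I_r -> G) : word_with_constants -> G :=
  free_prod_lift (fun c : G => c) (free_lift g).

Definition content : word_with_constants -> free_group r :=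
  free_prod_lift (fun _ : G => 1%g) (fun x : free_group r => x).

Definition singular (w : word_with_constants) : Prop := content w = 1%g.

Definition mixed_identity (w : word_with_constants) : Prop :=
  w <> 1%g /\ forall g : 'I_r -> G, substitute g w = 1%g.

End MixedIdentities.

Definition admits_nonsingular_mixed_identity (G : groupType) : Prop :=
  exists (r : nat) (w : word_with_constants G r),
    mixed_identity w /\ ~ singular w.

Local Open Scope ring_scope.

Section GeneralLinear.
Variables (F : fieldType) (V : lmodType F).

Record GL := MkGL {
  GL_fun :> V -> V;
  _ : `[< linear GL_fun /\ bijective GL_fun >]
}.
HB.instance Definition _ := [isSub for GL_fun].
HB.instance Definition _ := [Choice of GL by <:].

Lemma GL_linear (g : GL) : linear g.
Proof. by case: g => g /= /asboolP[]. Qed.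

Lemma GL_bij (g : GL) : bijective g.
Proof. by case: g => g /= /asboolP[]. Qed.

Lemma GL_ext (g h : GL) : (forall v, g v = h v) -> g = h.
Proof. by move=> gh; apply/val_inj/funext. Qed.

Fact GL_one_subproof : `[< linear (@idfun V) /\ bijective (@idfun V) >].
Proof. by apply/asboolP; split=> //; exists idfun. Qed.
Definition GL_one : GL := MkGL GL_one_subproof.

Fact GL_mul_subproof (g h : GL) : `[< linear (g \o h) /\ bijective (g \o h) >].
Proof.
apply/asboolP; split; last exact: bij_comp (GL_bij g) (GL_bij h).
by move=> a u v /=; rewrite !GL_linear.
Qed.
Definition GL_mul (g h : GL) : GL := MkGL (GL_mul_subproof g h).

Fact GL_inv_exists (g : GL) : exists h : GL, cancel g h /\ cancel h g.
Proof.
have [h gK hK] := GL_bij g.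
have hP : `[< linear h /\ bijective h >].
  apply/asboolP; split; last by exists g.
  by move=> a u v; rewrite -{1}(hK u) -{1}(hK v) -GL_linear gK.
by exists (MkGL hP).
Qed.
Definition GL_inv (g : GL) : GL := projT1 (cid (GL_inv_exists g)).

Lemma GL_invK (g : GL) : cancel g (GL_inv g) /\ cancel (GL_inv g) g.
Proof. by rewrite /GL_inv; case: cid. Qed.

Fact GL_mulA : associative GL_mul.
Proof. by move=> g h k; apply: GL_ext. Qed.
Fact GL_mul1 : left_id GL_one GL_mul.
Proof. by move=> g; apply: GL_ext. Qed.
Fact GL_mulr1 : right_id GL_one GL_mul.
Proof. by move=> g; apply: GL_ext. Qed.
Fact GL_mulV : left_inverse GL_one GL_inv GL_mul.
Proof. by move=> g; apply: GL_ext => v; apply: (GL_invK g).1. Qed.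
Fact GL_mulrV : right_inverse GL_one GL_inv GL_mul.
Proof. by move=> g; apply: GL_ext => v; apply: (GL_invK g).2. Qed.

HB.instance Definition _ :=
  isGroup.Build GL GL_mulA GL_mul1 GL_mulr1 GL_mulV GL_mulrV.

Lemma GL_mulE (g h : GL) v : (g * h)%g v = g (h v).
Proof. by []. Qed.

Definition preserves_form (f : {biscalar V}) : {pred GL} :=
  fun g => `[< forall u v, f (g u) (g v) = f u v >].

Fact preserves_form_closed (f : {biscalar V}) : group_closed (preserves_form f).
Proof.
split=> [|g h /asboolP fg /asboolP fh]; apply/asboolP => // u v.
have [_ hK] := GL_invK h.
by rewrite !GL_mulE fg -fh !hK.
Qed.

(* This is O(V) for f symmetric and Sp(V) for f alternating. *)
Definition isometry_group (f : {biscalar V}) := {g : GL | preserves_form f g}.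
HB.instance Definition _ f := SubChoice.on (isometry_group f).
HB.instance Definition _ f :=
  SubChoice_isSubGroup.Build GL (preserves_form f) (isometry_group f)
    (preserves_form_closed f).

Definition form_symmetric (f : {biscalar V}) : Prop := forall u v, f u v = f v u.
Definition form_alternating (f : {biscalar V}) : Prop := forall v, f v v = 0.

(* One side suffices, the forms considered being symmetric or alternating. *)
Definition form_nondegenerate (f : {biscalar V}) : Prop :=
  forall u, (forall v, f u v = 0) -> u = 0.

Definition is_countable_basis (e : nat -> V) : Prop :=
  (forall n (c : 'I_n -> F), \sum_(i < n) c i *: e i = 0 -> forall i, c i = 0) /\
  (forall v, exists n (c : 'I_n -> F), v = \sum_(i < n) c i *: e i).

(* V is isomorphic to the direct sum of countably many copies of F; see
   poly_countably_infinite_dimensional for a concrete model. *)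
Definition countably_infinite_dimensional : Prop := exists e, is_countable_basis e.

End GeneralLinear.

Lemma poly_countably_infinite_dimensional (F : fieldType) :
  countably_infinite_dimensional {poly F}.
Proof.
exists (fun i => 'X^i); split=> [n c c0 i | p].
  have: (\sum_(i < n) c i *: 'X^i)`_i = 0 by rewrite c0 coef0.
  rewrite coef_sum (bigD1 i) //= coefZ coefXn eqxx mulr1 big1 ?addr0 // => j ji.
  by rewrite coefZ coefXn eq_sym (inj_eq val_inj) (negPf ji) mulr0.
exists (size p), (fun i => p`_i); rewrite -[LHS]coefK poly_def.
by [].
Qed.

(* Main.v *)
(* Call a linear map finitary if it is a homothety plus an operator of finite
   rank.  A finitary constant n commutes with every element fixing a suitable
   finite set of data, so restricting the variables to such elements allows one
   to replace x n x^-1 by n without changing the content.  Hence one may assume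
   that no subword x n x^-1 has n finitary, and the word is still not constant.
   A vector v is then followed along the word: g(x) is altered by left
   multiplication by an h that fixes the points already used and moves the
   current point y to y + w.  As the next constant d is not finitary when the
   next letter is x^-1, w can be chosen so that d (y + w) is not in the span of
   a given finite set and y + w, and the trajectory never closes up.
   In the isometry groups w ranges over isotropic vectors, which exist in
   abundance because the sum of p - 1 mutually orthogonal vectors of norm b has
   norm -b in characteristic p; this treats all characteristics uniformly. *)
Require Import Defs.
From HB Require Import structures.
From mathcomp Require Import all_boot all_order all_algebra.
From mathcomp Require Import finfield boolp ring.

Set Implicit Arguments.
Unset Strict Implicit.
Unset Printing Implicit Defensive.

Import GRing.Theory.
Local Open Scope ring_scope.

(** * Finite spans and finitary maps *)

Section LinearAlgebra.
Variables (F : fieldType) (V : lmodType F).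
Implicit Types (s t B : seq V) (u v w : V) (P : V -> Prop) (g : V -> V).
Implicit Types (phi : V -> F) (Phi : seq (V -> F)).

Lemma linear_D (W : lmodType F) (h : V -> W) u v : linear h ->
  h (u + v) = h u + h v.
Proof. by move=> hL; rewrite -[u in LHS]scale1r hL scale1r. Qed.

Lemma linear_0 (W : lmodType F) (h : V -> W) : linear h -> h 0 = 0.
Proof. by move=> hL; apply: (addIr (h 0)); rewrite -linear_D // !add0r. Qed.

Lemma linear_Z (W : lmodType F) (h : V -> W) k v : linear h ->
  h (k *: v) = k *: h v.
Proof. by move=> hL; rewrite -[X in h X]addr0 hL linear_0 // addr0. Qed.

Lemma linear_B (W : lmodType F) (h : V -> W) u v : linear h ->
  h (u - v) = h u - h v.
Proof. by move=> hL; rewrite -!scaleN1r addrC hL addrC. Qed.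

Lemma scalar_D phi u v : scalar phi -> phi (u + v) = phi u + phi v.
Proof. by move=> pL; rewrite -[u in LHS]scale1r pL mul1r. Qed.

Lemma scalar_0 phi : scalar phi -> phi 0 = 0.
Proof. by move=> pL; apply: (addIr (phi 0)); rewrite -scalar_D // !add0r. Qed.

Lemma scalar_Z phi k v : scalar phi -> phi (k *: v) = k * phi v.
Proof. by move=> pL; rewrite -[X in phi X]addr0 pL scalar_0 // addr0. Qed.

Lemma scalar_B phi u v : scalar phi -> phi (u - v) = phi u - phi v.
Proof. by move=> pL; rewrite -scaleN1r addrC pL mulN1r addrC. Qed.

Definition subspace P := P 0 /\ forall k u v, P u -> P v -> P (k *: u + v).

Section Subspace.
Variables (P : V -> Prop) (sP : subspace P).

Lemma subspace0 : P 0. Proof. by case: sP. Qed.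

Lemma subspaceD u v : P u -> P v -> P (u + v).
Proof. by move=> Pu Pv; rewrite -[u]scale1r; apply: sP.2. Qed.

Lemma subspaceZ k u : P u -> P (k *: u).
Proof.
by move=> Pu; rewrite -[_ *: _]addr0; apply: sP.2 => //; apply: sP.1.
Qed.

Lemma subspaceB u v : P u -> P v -> P (u - v).
Proof. by move=> Pu Pv; rewrite -scaleN1r addrC; apply: sP.2. Qed.

End Subspace.

(** The recursion peels off one coefficient at a time, which suits induction on the list of
    generators. *)
Fixpoint in_span s v : Prop :=
  if s is a :: s' then exists k, in_span s' (v - k *: a) else v = 0.

Lemma span_subspace s : subspace (in_span s).
Proof.
elim: s => [|a s IHs] /=; split=> //=.
- by move=> k u v -> ->; rewrite scaler0 addr0.
- by exists 0; rewrite scale0r subr0; apply: subspace0.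
move=> k u v [i ui] [j vj]; exists (k * i + j).
rewrite scalerDl opprD addrACA -scalerA -scalerBr.
exact: IHs.2.
Qed.

Lemma span_mem s v : v \in s -> in_span s v.
Proof.
elim: s => //= a s IHs; rewrite inE => /orP[/eqP-> | /IHs sv].
  by exists 1; rewrite scale1r subrr; apply: (span_subspace s).1.
by exists 0; rewrite scale0r subr0.
Qed.

Lemma span_min s P : subspace P -> (forall a, a \in s -> P a) ->
  forall v, in_span s v -> P v.
Proof.
move=> sP; elim: s => [_ v -> | a s IHs Ps v [k vk]]; first exact: sP.1.
rewrite -(subrK (k *: a) v); apply: subspaceD => //.
  by apply: IHs vk => b sb; apply: Ps; rewrite inE sb orbT.
by apply: subspaceZ => //; apply: Ps; rewrite mem_head.
Qed.

Lemma span_sub s t v : {subset s <= t} -> in_span s v -> in_span t v.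
Proof.
move=> st; apply: span_min; first exact: span_subspace.
by move=> a /st; apply: span_mem.
Qed.

Lemma span_map s g v : linear g -> in_span s v -> in_span (map g s) (g v).
Proof.
move=> gL; pose P u := in_span (map g s) (g u).
apply: (@span_min s P); rewrite /P.
  have sP := span_subspace (map g s).
  split; first by rewrite linear_0 //; apply: sP.1.
  by move=> k x y gx gy; rewrite gL; apply: sP.2.
by move=> a sa; apply/span_mem/map_f.
Qed.

Lemma span_kills phi s v : scalar phi -> (forall a, a \in s -> phi a = 0) ->
  in_span s v -> phi v = 0.
Proof.
move=> pL phis; apply: (@span_min s (fun v => phi v = 0)) => //; split.
  exact: scalar_0.
by move=> k x y px py; rewrite pL px py mulr0 addr0.
Qed.

Definition finitary g := exists k s, forall v, in_span s (g v - k *: v).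

Definition infinite_dim := forall s, exists v, ~ in_span s v.

(** Each new functional either vanishes on the common kernel of the others, or one vector of that
    kernel on which it does not vanish is added to [s]. *)
Lemma common_kernel_cofinite Phi : (forall phi, phi \in Phi -> scalar phi) ->
  exists s, forall v, exists2 x, (forall phi, phi \in Phi -> phi x = 0)
    & in_span s (v - x).
Proof.
elim: Phi => [|phi Phi IHP] PL.
  by exists [::] => v; exists v => //=; rewrite subrr.
have pL : scalar phi by apply: PL; rewrite mem_head.
have [|s sP] := IHP; first by move=> psi Ppsi; apply: PL; rewrite inE Ppsi orbT.
have [[x Phix phix] | noPhi] := pselect
    (exists2 x, (forall psi, psi \in Phi -> psi x = 0) & phi x <> 0).
  exists (x :: s) => v.
  have [y Phiy sy] := sP v.
  exists (y - (phi y / phi x) *: x).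
    move=> psi; rewrite inE => /orP[/eqP-> | Ppsi].
      by rewrite scalar_B // scalar_Z // divfK ?subrr //; apply/eqP.
    have psiL : scalar psi by apply: PL; rewrite inE Ppsi orbT.
    by rewrite scalar_B // scalar_Z // (Phiy _ Ppsi) (Phix _ Ppsi) mulr0 subr0.
  by exists (phi y / phi x); rewrite opprB addrA addrAC addrK.
exists s => v; have [y Phiy sy] := sP v; exists y => // psi.
rewrite inE => /orP[/eqP-> | /Phiy//].
by apply: contrapT => py; apply: noPhi; exists y.
Qed.

Lemma common_kernel_avoid Phi s : infinite_dim ->
    (forall phi, phi \in Phi -> scalar phi) ->
  exists2 x, (forall phi, phi \in Phi -> phi x = 0) & ~ in_span s x.
Proof.
move=> Vinf /common_kernel_cofinite[t tP]; have [v sv] := Vinf (s ++ t).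
have [x Phix tx] := tP v; exists x => // sx; apply: sv.
rewrite -(subrK x v); apply: subspaceD; first exact: span_subspace.
  by apply: span_sub tx => a ta; rewrite mem_cat ta orbT.
by apply: span_sub sx => a sa; rewrite mem_cat sa.
Qed.

(** * Separation from finite spans by a class of functionals *)

Section Separation.
Variable L : (V -> F) -> Prop.
Hypothesis L_scalar : forall phi, L phi -> scalar phi.
Hypothesis L_comb : forall k phi psi, L phi -> L psi ->
  L (fun v => k * phi v + psi v).
Hypothesis L_sep : forall v, (forall phi, L phi -> phi v = 0) -> v = 0.

Lemma span_separation s y : ~ in_span s y ->
  exists phi, [/\ L phi, forall a, a \in s -> phi a = 0 & phi y = 1].
Proof.
suff span_bidual z : (forall phi, L phi -> (forall a, a \in s -> phi a = 0) ->
    phi z = 0) -> in_span s z.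
  move=> sy; have [phi] : exists phi,
    [/\ L phi, forall a, a \in s -> phi a = 0 & phi y <> 0].
    apply: contrapT => no; apply: sy; apply: span_bidual => phi Lphi phis.
    by apply: contrapT => phiy; apply: no; exists phi.
  move=> [Lphi phis /eqP phiy].
  (* This is [phi v / phi y], in the shape required by [L_comb]. *)
  exists (fun v => ((phi y)^-1 - 1) * phi v + phi v); split.
  - exact: L_comb.
  - by move=> a /phis->; rewrite mulr0 addr0.
  by rewrite mulrBl mulVf // mul1r subrK.
elim: s z => [|a s IHs] z Hz /=; first by apply: L_sep => phi /Hz->.
case: (pselect (exists phi,
    [/\ L phi, forall b, b \in s -> phi b = 0 & phi a <> 0])); last first.
  move=> no; exists 0; rewrite scale0r subr0; apply: IHs => phi Lphi phis.
  apply: Hz => // b; rewrite inE => /orP[/eqP-> | /phis//].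
  by apply: contrapT => phia; apply: no; exists phi.
move=> [phi [Lphi phis /eqP phia]]; exists (phi z / phi a).
apply: IHs => psi Lpsi psis.
(* Correcting [psi] by a multiple of [phi] makes it vanish at [a] too, so that [Hz] applies. *)
have chiL : L (fun v => - (psi a / phi a) * phi v + psi v) by apply: L_comb.
have := Hz _ chiL; rewrite (scalar_B _ _ (L_scalar Lpsi)).
rewrite (scalar_Z _ _ (L_scalar Lpsi)) => Hchi.
rewrite -[RHS]Hchi.
  rewrite mulNr [RHS]addrC; congr (_ - _).
  by rewrite mulrAC [RHS]mulrAC [psi a * _]mulrC.
move=> b; rewrite inE => /orP[/eqP-> | sb].
  by rewrite mulNr divfK // addrC subrr.
by rewrite (phis b sb) (psis b sb) mulr0 addr0.
Qed.

(** Used to reduce an equality between vectors of a finite span to finitely many scalar equations.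
    When [a] is outside the span of [s], a functional killing [s] but not [a] is added. *)
Lemma span_norming s : exists Psi : seq (V -> F),
  (forall psi, psi \in Psi -> L psi) /\
  forall x, in_span s x -> (forall psi, psi \in Psi -> psi x = 0) -> x = 0.
Proof.
elim: s => [|a s [Psi [PsiL PsiP]]]; first by exists [::].
case: (pselect (in_span s a)) => sa.
  exists Psi; split=> // x /= [k sx]; apply: PsiP.
  rewrite -(subrK (k *: a) x); have sS := span_subspace s.
  by apply: subspaceD => //; apply: subspaceZ.
have [phi [Lphi phis phia]] := span_separation sa.
exists (phi :: Psi); split=> [psi | x [k sx] Hx].
  by rewrite inE => /orP[/eqP-> | /PsiL].
have k0 : k = 0.
  have phiL := L_scalar Lphi.
  have: phi (x - k *: a) = 0 by apply: span_kills sx.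
  rewrite scalar_B // scalar_Z // phia mulr1 Hx ?mem_head // sub0r.
  by move/eqP; rewrite oppr_eq0 => /eqP.
apply: PsiP => [|psi Ppsi]; first by rewrite k0 scale0r subr0 in sx.
by apply: Hx; rewrite inE Ppsi orbT.
Qed.

End Separation.

(** Modulo the span of [s], the vectors [w], [x] and [w + x] are eigenvectors. Comparison gives
    [(k - m) *: w + (l - m) *: x] in that span; as [x] is independent of [w] and [s], [l = m], and
    then [(k - m) *: w] lies in the span. *)
Lemma common_multiplier g s w x k l m : linear g ->
    in_span s (g w - k *: w) -> in_span s (g x - l *: x) ->
    in_span s (g (w + x) - m *: (w + x)) -> ~ in_span (w :: s) x ->
  in_span s (g w - l *: w).
Proof.
move=> gL sw sx swx wx; have sS := span_subspace s.
have comb : in_span s ((k - m) *: w + (l - m) *: x).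
  have E : g (w + x) - m *: (w + x) =
      (g w - k *: w + (g x - l *: x)) + ((k - m) *: w + (l - m) *: x).
    rewrite !scalerBl [RHS]addrACA !subrKA linear_D // scalerDr opprD.
    exact: addrACA.
  rewrite E in swx; set r := _ + (g x - _) in swx.
  rewrite -[X in in_span _ X](addKr r) addrC.
  by apply: subspaceB => //; apply: subspaceD.
have [lm | lm] := eqVneq l m.
  rewrite lm; have -> : g w - m *: w = g w - k *: w + (k - m) *: w.
    by rewrite scalerBl subrKA.
  by apply: subspaceD => //; move: comb; rewrite lm subrr scale0r addr0.
case: wx; exists (- ((l - m)^-1 * (k - m))).
have -> : x - - ((l - m)^-1 * (k - m)) *: w =
    (l - m)^-1 *: ((k - m) *: w + (l - m) *: x).
  rewrite scalerDr !scalerA mulVf ?subr_eq0 // scale1r addrC.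
  by rewrite scaleNr opprK.
exact: subspaceZ.
Qed.

(** Comparison with a fixed [w0] outside the span of [s] yields one multiplier [k0] for all of [Q].
    The subspace that [g - k0] maps into the span of [s] then contains [Q], hence has finite
    codimension. The set [Q] may fail to be a subspace, as isotropic vectors do. *)
Lemma finitary_of_local_multipliers g (Q : V -> Prop) s : linear g -> Q 0 ->
    (forall w1 w2 t, Q w1 -> Q w2 ->
       exists x, [/\ Q x, Q (w1 + x), Q (w2 + x) & ~ in_span t x]) ->
    (forall P, subspace P -> (forall w, Q w -> P w) ->
       exists t, forall v, exists2 x, P x & in_span t (v - x)) ->
    (forall w, Q w -> exists k, in_span s (g w - k *: w)) ->
  finitary g.
Proof.
move=> gL Q0 Qext Qspan Qg; have sS := span_subspace s.
have [w0 [Qw0 _ _ sw0]] := Qext 0 0 s Q0 Q0.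
have [k0 gw0] := Qg _ Qw0.
have Qk0 w : Q w -> in_span s (g w - k0 *: w).
  (* One [x] independent of both [w] and [w0] transfers its multiplier [l] to both. *)
  move=> Qw; have [x [Qx Qwx Qw0x xt]] := Qext w w0 (w :: w0 :: s) Qw Qw0.
  have [[k gw] [l gx]] := (Qg _ Qw, Qg _ Qx).
  have [[m gwx] [n gw0x]] := (Qg _ Qwx, Qg _ Qw0x).
  have xw : ~ in_span (w :: s) x.
    move=> sx; apply: xt; apply: span_sub sx => a.
    by rewrite !inE => /orP[->|->]; rewrite ?orbT.
  have xw0 : ~ in_span (w0 :: s) x.
    move=> sx; apply: xt; apply: span_sub sx => a.
    by rewrite !inE => /orP[->|->]; rewrite ?orbT.
  have gwl := common_multiplier gL gw gx gwx xw.
  have gw0l := common_multiplier gL gw0 gx gw0x xw0.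
  (* Two distinct multipliers for [w0] would put [w0] in the span of [s]. *)
  suff -> : k0 = l by [].
  apply: contrapT => /eqP; rewrite -subr_eq0 => kl; apply: sw0.
  have: in_span s ((k0 - l) *: w0).
    have -> : (k0 - l) *: w0 = (g w0 - l *: w0) - (g w0 - k0 *: w0).
      by rewrite opprB [RHS]addrC subrKA scalerBl.
    exact: subspaceB.
  by move/(subspaceZ sS (k0 - l)^-1); rewrite scalerA mulVf // scale1r.
pose P w := in_span s (g w - k0 *: w).
have sP : subspace P.
  split; rewrite /P; first by rewrite linear_0 // scaler0 subr0; apply: sS.1.
  move=> k u v Pu Pv; rewrite gL scalerDr opprD addrACA scalerA mulrC -scalerA.
  by rewrite -scalerBr; apply: sS.2.
have [t tP] := Qspan P sP Qk0; pose h v := g v - k0 *: v.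
have hL : linear h.
  move=> k u v; rewrite /h gL scalerDr opprD addrACA scalerA mulrC -scalerA.
  by rewrite -scalerBr.
exists k0, (s ++ map h t) => v; have [x Px tx] := tP v.
rewrite -/(h v) -(subrK x v) linear_D //.
apply: subspaceD; first exact: span_subspace.
  by apply: span_sub (span_map hL tx) => a ta; rewrite mem_cat ta orbT.
by apply: span_sub Px => a sa; rewrite mem_cat sa.
Qed.

End LinearAlgebra.

(** * Words with constants *)

Section AlternatingWords.
Variables (G : groupType) (r : nat).
Local Notation letter := ('I_r * bool)%type.
Implicit Types (x : letter) (c d : G) (l : seq (G * letter)).

Definition letter_inv x : letter := (x.1, ~~ x.2).

Lemma letter_invK : involutive letter_inv.
Proof. by case=> i b; rewrite /letter_inv negbK. Qed.

Lemma letter_inv_neq x : letter_inv x != x.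
Proof. by case: x => i [] /=; rewrite /letter_inv xpair_eqE andbF. Qed.

(* The pair (c, [:: (d1, x1); ...; (dn, xn)]) stands for the word
   d1 x1 d2 x2 ... dn xn c. *)
Definition alt_eval (g : letter -> G) c l : G :=
  (foldr (fun p a => p.1 * (g p.2 * a)) c l)%g.

Definition alt_content l : free_group r := word_class _ [seq p.2 | p <- l].

Definition with_inverses (g : 'I_r -> G) x : G :=
  if x.2 then (g x.1)^-1%g else g x.1.

(** Values are assigned to all letters, so that a generator and its inverse play symmetric roles. *)
Definition inverse_compatible (g : letter -> G) :=
  forall x, g (letter_inv x) = (g x)^-1%g.

Lemma compatible_with_inverses g : inverse_compatible g ->
  with_inverses (fun i => g (i, false)) =1 g.
Proof. by move=> gV [i []] //; rewrite /with_inverses /= -gV. Qed.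

Lemma eq_alt_eval g h c l : g =1 h -> alt_eval g c l = alt_eval h c l.
Proof. by move=> gh; elim: l => //= p l ->; rewrite gh. Qed.

Lemma word_eval_inv (K : groupType) (phi : 'I_r -> K) (u : seq letter) :
  word_eval phi (word_inv u) = (word_eval phi u)^-1%g.
Proof.
apply: (mulIg (word_eval phi u)); rewrite mulVg -word_eval_cat.
apply: (@word_eval_cong _ (fun _ _ => False) _ _ _ _ [::]) => //.
exact: word_invl.
Qed.

Lemma alt_eval_letters g (u : seq letter) c l :
  alt_eval (with_inverses g) c ([seq (1%g, x) | x <- u] ++ l) =
    (word_eval g u * alt_eval (with_inverses g) c l)%g.
Proof. by elim: u => /= [|x u ->]; rewrite !mul1g ?mulgA. Qed.

(** The factor [d] is absorbed by the first constant, which is [c] when [l] is empty; everything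
    after the first pair is kept, which later preserves reducedness. *)
Lemma alt_eval_mull d c l : exists c' l',
  [/\ [seq p.2 | p <- l'] = [seq p.2 | p <- l], behead l' = behead l
    & forall g, alt_eval g c' l' = (d * alt_eval g c l)%g].
Proof.
case: l => [|[d1 x] l]; first by exists (d * c)%g, [::].
by exists c, ((d * d1, x)%g :: l); split=> // g /=; rewrite -mulgA.
Qed.

(** Elements of [G] are absorbed into the leading constant; elements of the free group are spelled
    out as letters preceded by the constant 1. *)
Lemma alternating_word_exists (w : word_with_constants G r) : exists c l,
  content w = alt_content l /\
  forall g, substitute g w = alt_eval (with_inverses g) c l.
Proof.
rewrite /content /substitute /free_prod_lift /presented_lift.
elim: (word_repr w) => [|[[a|x] b] u [c [l [ul gul]]]].
- by exists 1%g, [::].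
- have [c' [l' [ll' _ el']]] := alt_eval_mull (if b then a^-1 else a)%g c l.
  exists c', l'; split=> [|g]; last by rewrite el' -gul.
  by rewrite /= ul /alt_content ll'; case: b {el'}; rewrite ?invg1 mul1g.
pose ys := if b then word_inv (word_repr x) else word_repr x.
exists c, ([seq (1%g, y) | y <- ys] ++ l); split=> [|g].
  rewrite /= ul /alt_content map_cat -map_comp map_id -presented_mulE.
  congr (_ * _)%g; rewrite /ys; case: b {ys} => //.
  by rewrite word_reprK.
rewrite alt_eval_letters -gul /=; congr (_ * _)%g.
by rewrite /ys; case: b {ys}; rewrite ?word_eval_inv.
Qed.

End AlternatingWords.

(** * A criterion for the absence of mixed identities *)

Section Criterion.
Variables (F : fieldType) (V : lmodType F) (G : groupType).
Variable act : G -> V -> V.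
Hypotheses (act_linear : forall g, linear (act g))
  (act1 : forall v, act 1%g v = v)
  (actM : forall g h v, act (g * h)%g v = act g (act h v)).

(** [T] indexes finite data, [H k] is the subgroup respecting the data [k], and [U k] lists vectors
    fixed by it. In [H_moves], [Q] is a set of possible displacements of [y]. *)
Variables (T : Type) (t0 : T) (H : T -> G -> Prop) (U : T -> seq V).
Hypotheses (H1 : forall k, H k 1%g)
  (HM : forall k g h, H k g -> H k h -> H k (g * h)%g)
  (HV : forall k g, H k g -> H k g^-1%g)
  (H_directed : forall k1 k2, exists k, forall g, H k g -> H k1 g /\ H k2 g)
  (H_fix : forall k g u, H k g -> u \in U k -> act g u = u)
  (H_centralizes : forall n, finitary (act n) ->
     exists k, forall g, H k g -> (g * n = n * g)%g)
  (H_moves : forall k s y, ~ in_span (U k ++ s) y ->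
     exists Q : V -> Prop, [/\ Q 0,
       forall w1 w2 t, Q w1 -> Q w2 ->
         exists x, [/\ Q x, Q (w1 + x), Q (w2 + x) & ~ in_span t x],
       forall P, subspace P -> (forall w, Q w -> P w) ->
         exists t, forall v, exists2 x, P x & in_span t (v - x)
     & forall w, Q w ->
         exists h, [/\ H k h, forall a, a \in s -> act h a = a
                     & act h y = y + w]]).
Hypothesis V_inf : infinite_dim V.

Lemma actK g : cancel (act g) (act g^-1%g).
Proof. by move=> v; rewrite -actM mulVg act1. Qed.

Lemma actKV g : cancel (act g^-1%g) (act g).
Proof. by move=> v; rewrite -actM mulgV act1. Qed.

Lemma move_avoid k s y B : ~ in_span (U k ++ s) y ->
  exists h, [/\ H k h, forall a, a \in s -> act h a = a
              & ~ in_span B (act h y)].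
Proof.
move=> /H_moves[Q [Q0 Qext _ Qh]].
have [w [Qw _ _ yBw]] := Qext 0 0 (y :: B) Q0 Q0.
have [h [Hh hs hy]] := Qh w Qw; exists h; split=> //; rewrite hy => Byw.
by apply: yBw; exists (-1); rewrite scaleN1r opprK addrC.
Qed.

(** If no [h] worked, every [y + w] would be an eigenvector of [d] modulo [B], so [d] would have
    local multipliers on [Q] and be finitary. *)
Lemma move_nonfinitary k s y B d : ~ in_span (U k ++ s) y ->
    ~ finitary (act d) ->
  exists h, [/\ H k h, forall a, a \in s -> act h a = a
              & ~ in_span (act h y :: B) (act d (act h y))].
Proof.
move=> /H_moves[Q [Q0 Qext Qspan Qh]] dN; apply: contrapT => no.
have dL := act_linear d; apply: dN.
apply: (finitary_of_local_multipliers (s := y :: act d y :: B) dL Q0) => //.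
move=> w Qw.
have [h [Hh hs hy]] := Qh w Qw.
have [m Bm] : in_span (act h y :: B) (act d (act h y)).
  by apply: contrapT => Bh; apply: no; exists h.
(* The multiplier of [w] is [m]; the coefficients of [y] and [act d y] come from expanding
   [d (y + w) - m *: (y + w)]. *)
exists m, m, (-1); move: Bm; rewrite hy linear_D // scalerDr scaleN1r opprK.
rewrite opprD addrACA [X in in_span _ X -> _]addrC -!addrA.
by rewrite [- (m *: y) + _]addrC.
Qed.

Section Rank.
Variable r : nat.
Local Notation letter := ('I_r * bool)%type.
Implicit Types (x : letter) (c d : G) (l : seq (G * letter)).

(** Says that [x] may be put in front of [l]. As 1 is finitary, this includes ordinary free
    reduction. *)
Definition admissible x l : Prop :=
  if l is (d, x1) :: _ then x1 = letter_inv x -> ~ finitary (act d) else True.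

Fixpoint reduced l : Prop :=
  if l is (_, x) :: l' then admissible x l' /\ reduced l' else True.

(** Induction on [l]: an inadmissible new letter starts some [x d2 x^-1] with [d2] finitary, which
    is replaced by [d2] and merged with the neighbouring constants. Values agree on [H k] only, and
    [k] is refined at each such replacement. *)
Lemma alternating_reduction c l : exists k c' l',
  [/\ reduced l', alt_content l' = alt_content l
    & forall g, inverse_compatible g -> (forall x, H k (g x)) ->
        alt_eval g c' l' = alt_eval g c l].
Proof.
elim: l => [|[d x] l [k [c' [l' [l'red ll' ell']]]]].
  by exists t0, c, [::].
have contE y (u : seq (G * letter)) e :
    alt_content ((e, y) :: u) =
    (word_class _ [:: y] * alt_content u)%g :> free_group r.
  by rewrite -cat1s /alt_content map_cat -presented_mulE.
have [xl' | xl'] := pselect (admissible x l').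
  exists k, c', ((d, x) :: l'); split; first by split.
    by rewrite contE ll' -(contE x l d).
  by move=> g gV gH /=; rewrite ell'.
case: l' l'red ll' ell' xl' => [|[d2 x2] l''] //= [x2l'' l''red] ll' ell' no.
have x2E : x2 = letter_inv x by apply: contrapT => x2x; apply: no => /x2x.
have d2N : finitary (act d2) by apply: contrapT => d2N; apply: no.
have [k2 k2P] := H_centralizes d2N; have [k3 k3P] := H_directed k k2.
have [c3 [l3 [l3E l3b el3]]] := alt_eval_mull (d * d2) c' l''.
exists k3, c3, l3; split=> [||g gV gH].
(* Merging alters only the first constant, which [reduced] does not inspect. *)
- case: l'' l3 l3E l3b l''red {ll' ell' x2l'' el3 no} =>
    [|[d4 x4] l''] [|[d3 x3] l3] //=.
  by move=> [-> _] ->.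
- have -> : alt_content l3 = alt_content l'' by rewrite /alt_content l3E.
  rewrite contE -ll' contE mulgA x2E.
  rewrite [X in _ = (X * _)%g](_ : _ = 1%g) ?mul1g //.
  rewrite [LHS]presented_mulE; apply/word_classP.
  by rewrite /letter_inv; case: x {no x2E} => i b; apply: cong_cancel.
rewrite el3 /= -ell' //=; last by move=> y; apply: (k3P _ (gH y)).1.
rewrite x2E gV !mulgA; congr (_ * _)%g; rewrite -!mulgA; congr (_ * _)%g.
by rewrite mulgA (k2P (g x)) ?mulgK //; apply: (k3P _ (gH x)).2.
Qed.

(** * Following a vector along a reduced word *)

Section Trajectory.
Variable k : T.

(* S x is the set of points at which the action of g x has been prescribed;
   the steps of a trajectory only alter g outside these sets. *)
Record partial_choice (g : letter -> G) (S : letter -> seq V) : Prop := {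
  choice_compatible : inverse_compatible g;
  choice_in : forall x, H k (g x);
  choice_closed : forall x a, a \in S x -> act (g x) a \in S (letter_inv x)
}.

Definition extends (g g' : letter -> G) (S : letter -> seq V) :=
  forall x a, a \in S x -> act (g' x) a = act (g x) a.

(** Replacing [g x] by [h * g x], with [h] fixing the images already prescribed, keeps the old
    values and frees the image of [y]. Here [x0] is the letter applied next. *)
Lemma trajectory_step g S x y d x0 B : partial_choice g S ->
    ~ in_span (U k ++ S x) y -> (x = letter_inv x0 -> ~ finitary (act d)) ->
  exists g' S', [/\ partial_choice g' S', extends g g' S,
    forall z, {subset S z <= S' z}, y \in S' x
    & ~ in_span (B ++ S' x0) (act d (act (g' x) y))].
Proof.
move=> [gV gH gS] Sy xd; pose x' := letter_inv x.
have x'V : letter_inv x' = x by apply: letter_invK.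
have x'x : (x' == x) = false by apply/negbTE/letter_inv_neq.
(* The inverse of [g x] fixes [U k] and maps [S x'] into [S x], so a dependence could be pulled back
   to [y]. *)
have S'z : ~ in_span (U k ++ S x') (act (g x) y).
  move=> /(span_map (act_linear (g x)^-1%g)); rewrite actK => Uy; apply: Sy.
  apply: span_sub Uy => _ /mapP[a + ->]; rewrite !mem_cat -gV -/x'.
  move=> /orP[Ua | /gS]; first by rewrite (H_fix (gH _)) ?Ua.
  by rewrite x'V => ->; rewrite orbT.
(* The conditional anticipates [S' x0]. Only for [x0 = x'] does it contain the moved point itself,
   and there [d] is not finitary. *)
have [h [Hh hS hB]] : exists h, [/\ H k h,
    forall a, a \in S x' -> act h a = a
    & ~ in_span (B ++ (if x0 == x then y :: S x else
                       if x0 == x' then act h (act (g x) y) :: S x'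
                       else S x0)) (act d (act h (act (g x) y)))].
  have [x0x' | x0x'] := eqVneq x0 x'.
    have dN : ~ finitary (act d) by apply: xd; rewrite x0x' x'V.
    have [h [Hh hS hB]] := move_nonfinitary (B ++ S x') S'z dN.
    exists h; split=> //; rewrite x0x' x'x => sB; apply: hB; apply: span_sub sB.
    by move=> a; rewrite !(mem_cat, inE) orbCA.
  pose B' := B ++ (if x0 == x then y :: S x else S x0).
  have [h [Hh hS hB]] := move_avoid (map (act d^-1%g) B') S'z.
  exists h; split=> // sB; apply: hB; rewrite -[X in in_span _ X](actK d).
  exact: span_map.
pose g' z := if z == x then (h * g x)%g else
             if z == x' then (g x' * h^-1)%g else g z.
pose z := act h (act (g x) y).
pose S' u := if u == x then y :: S x else if u == x' then z :: S x' else S u.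
have g'x : g' x = (h * g x)%g by rewrite /g' eqxx.
have g'x' : g' x' = (g x' * h^-1)%g by rewrite /g' x'x eqxx.
have S'x : S' x = y :: S x by rewrite /S' eqxx.
have S'x' : S' x' = z :: S x' by rewrite /S' x'x eqxx.
have hVS a : a \in S x' -> act h^-1%g a = a.
  by move=> Sa; rewrite -{1}(hS a Sa) actK.
have gg' : extends g g' S.
  move=> u a; rewrite /g'; have [-> | ux] := eqVneq u x.
    by move=> Sa; rewrite actM hS //; apply: gS.
  by have [-> | //] := eqVneq u x' => Sa; rewrite actM hVS.
exists g', S'; split=> //.
- split.
  + move=> u; have [-> | ux] := eqVneq u x.
      by rewrite -/x' g'x g'x' invgM -gV.
    have [-> | ux'] := eqVneq u x'.
      by rewrite x'V g'x g'x' invgM invgK -gV x'V.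
    rewrite /g' (negPf ux) (negPf ux') !(inv_eq (@letter_invK r)) -/x' x'V.
    by rewrite (negPf ux) (negPf ux').
  + move=> u; rewrite /g'; case: eqP => _; first exact: HM.
    by case: eqP => _ //; apply: HM => //; apply: HV.
  move=> u a; have [-> | ux] := eqVneq u x.
    rewrite S'x -/x' S'x' !inE => /orP[/eqP-> | Sa].
      by rewrite g'x actM eqxx.
    by rewrite gg' // gS ?orbT.
  have [-> | ux'] := eqVneq u x'.
    rewrite S'x' x'V S'x !inE => /orP[/eqP-> | Sa].
      by rewrite g'x' actM actK gV actK eqxx.
    by rewrite gg' //; have := gS _ _ Sa; rewrite x'V => ->; rewrite orbT.
  rewrite /S' (negPf ux) (negPf ux') !(inv_eq (@letter_invK r)) -/x' x'V.
  by rewrite (negPf ux) (negPf ux') => Sa; rewrite gg' // gS.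
- move=> u a; rewrite /S'; case: eqP => [-> | _].
    by rewrite inE orbC => ->.
  by case: eqP => [-> | _] //; rewrite inE orbC => ->.
- by rewrite S'x mem_head.
by rewrite g'x actM.
Qed.

(** Induction from the right end of the word. The invariant keeps the current point independent of
    [U k] and of the points prescribed for the next letter [x0]; the clause on [extends] says that
    later steps do not disturb the path. *)
Lemma trajectory c l v x0 : ~ in_span (U k) (act c v) ->
    admissible x0 l -> reduced l ->
  exists g S, [/\ partial_choice g S,
    forall h, extends g h S -> act (alt_eval h c l) v = act (alt_eval g c l) v,
    ~ in_span (U k ++ S x0) (act (alt_eval g c l) v)
    & l <> [::] -> act (alt_eval g c l) v <> v].
Proof.
move=> cv; elim: l x0 => [|[d x] l IHl] x0 /= x0l.
  move=> _; exists (fun=> 1%g), (fun=> [::]); split=> //.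
    by split=> // x; rewrite invg1.
  by rewrite cats0.
move=> [xl lred]; have [g [S [gS gl Sy _]]] := IHl _ xl lred.
(* Including [v] among the vectors to avoid gives the last conclusion. *)
have [g' [S' [g'S' gg' SS' yS' eS']]] := trajectory_step (v :: U k) gS Sy x0l.
have lE h : extends g' h S' ->
    act (alt_eval h c ((d, x) :: l)) v =
    act d (act (g' x) (act (alt_eval g c l) v)).
  move=> g'h /=; rewrite !actM gl ?g'h //.
  by move=> u a Sa; rewrite g'h ?gg' //; apply: SS'.
exists g', S'; rewrite -/(alt_eval g' c ((d, x) :: l)) lE //.
split=> //.
  move=> s; apply: eS'; apply: span_sub s => a.
  by rewrite mem_cat => /orP[] aS; rewrite inE mem_cat aS ?orbT.
by move=> _ vE; apply: eS'; rewrite vE; apply/span_mem; rewrite mem_head.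
Qed.

End Trajectory.

Lemma no_identity_of_alternating c l : alt_content l <> 1%g ->
  ~ forall g : 'I_r -> G, alt_eval (with_inverses g) c l = 1%g.
Proof.
move=> l1 eval1.
have [k [c' [l' [l'red ll' ell']]]] := alternating_reduction c l.
have [v0 Uv0] := V_inf (U k); pose v := act c'^-1%g v0.
have cv : ~ in_span (U k) (act c' v) by rewrite actKV.
(* A next letter has to be supplied: repeating the first letter is admissible, since no letter is
   its own inverse. *)
have [x l'x] : exists x, admissible x l'.
  case: l' {l'red ell'} ll' => [ll' | [d x] l' _].
    by case: l1; rewrite -ll'.
  by exists x => /eqP; rewrite eq_sym (negPf (letter_inv_neq x)).
have [g [S [[gV gH _] _ _ gv]]] := trajectory cv l'x l'red.
have l'0 : l' <> [::] by move=> l'0; case: l1; rewrite -ll' l'0.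
case: (gv l'0); rewrite ell' //.
rewrite -(eq_alt_eval _ _ (compatible_with_inverses gV)).
by rewrite eval1 act1.
Qed.

End Rank.

Lemma no_nonsingular_mixed_identity : ~ admits_nonsingular_mixed_identity G.
Proof.
move=> [r [w [[_ w1] ws]]]; have [c [l [wl wE]]] := alternating_word_exists w.
apply: (@no_identity_of_alternating r c l); first by rewrite -wl.
by move=> g; rewrite -wE.
Qed.

End Criterion.

(** * The general linear group *)

Lemma fix_span (F : fieldType) (V : lmodType F) (g : V -> V) (s : seq V) v :
  linear g -> (forall a, a \in s -> g a = a) -> in_span s v -> g v = v.
Proof.
move=> gL gs; apply: (@span_min _ _ s (fun v => g v = v)) => //; split.
  exact: linear_0.
by move=> k x y gx gy; rewrite gL gx gy.
Qed.

(** Since [g] fixes the range of [n - k], commutation amounts to [(n - k) (g v) = (n - k) v], an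
    equality inside the span of [s] that [Psi] detects. *)
Lemma commute_finitary (F : fieldType) (V : lmodType F) (g n : V -> V) k
    (s : seq V) (Psi : seq (V -> F)) :
    linear g -> (forall v, in_span s (n v - k *: v)) ->
    (forall a, a \in s -> g a = a) ->
    (forall psi, psi \in Psi -> scalar psi) ->
    (forall x, in_span s x ->
       (forall psi, psi \in Psi -> psi x = 0) -> x = 0) ->
    (forall psi v, psi \in Psi ->
       psi (n (g v) - k *: g v) = psi (n v - k *: v)) ->
  forall v, g (n v) = n (g v).
Proof.
move=> gL ns gs PsiL Psi0 Psig v.
have /eqP : n (g v) - k *: g v - (n v - k *: v) = 0.
  apply: Psi0 => [|psi Ppsi].
    by apply: subspaceB => //; apply: span_subspace.
  by rewrite (scalar_B _ _ (PsiL _ Ppsi)) Psig ?subrr.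
rewrite subr_eq0 => /eqP nE; rewrite -(subrK (k *: g v) (n (g v))) nE.
by rewrite -(fix_span gL gs (ns v)) -linear_Z // -linear_D // subrK.
Qed.

(** * Coordinates with respect to a countable basis *)

Section CountableBasis.
Variables (F : fieldType) (V : lmodType F).
Variable e : nat -> V.
Hypothesis e_basis : is_countable_basis e.

Lemma delta_combination n i : (i < n)%N ->
  \sum_(k < n) ((k : nat) == i)%:R *: e k = e i.
Proof.
move=> ltin; rewrite (bigD1 (Ordinal ltin)) //= eqxx scale1r big1 ?addr0 //.
by move=> j; rewrite -val_eqE /= => /negPf->; rewrite scale0r.
Qed.

Lemma basis_inj : injective e.
Proof.
move=> i j eij; apply/eqP; apply: contraT => ij.
have [lei lej] : (i < (maxn i j).+1)%N /\ (j < (maxn i j).+1)%N.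
  by rewrite !ltnS leq_maxl leq_maxr.
have := e_basis.1 _ (fun k : 'I_(maxn i j).+1 =>
  ((k : nat) == i)%:R - ((k : nat) == j)%:R).
rewrite (eq_bigr _ (fun k _ => scalerBl _ _ _)) sumrB !delta_combination //.
rewrite eij subrr => /(_ erefl (Ordinal lei)) /=.
by rewrite eqxx (negPf ij) subr0 => /eqP; rewrite oner_eq0.
Qed.

(** Polynomials serve as finitely supported coordinate sequences; this is the resulting isomorphism
    onto [V]. *)
Definition basis_combination (p : {poly F}) : V :=
  \sum_(i < size p) p`_i *: e i.

Lemma basis_combinationE (p : {poly F}) n : (size p <= n)%N ->
  basis_combination p = \sum_(i < n) p`_i *: e i.
Proof.
move=> pn; rewrite /basis_combination.
rewrite (big_ord_widen n (fun i => p`_i *: e i)) //.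
rewrite big_mkcond; apply: eq_bigr => i _; case: ltnP => // /(nth_default 0)->.
by rewrite scale0r.
Qed.

Lemma basis_combination_linear : linear basis_combination.
Proof.
move=> k p q; pose n := maxn (size (k *: p + q)) (maxn (size p) (size q)).
rewrite !(@basis_combinationE _ n) ?leq_max ?leqnn ?orbT //.
rewrite scaler_sumr -big_split; apply: eq_bigr => i _ /=.
by rewrite coefD coefZ scalerDl scalerA.
Qed.

Lemma basis_combination_inj : injective basis_combination.
Proof.
move=> p q pq; apply/eqP; rewrite -subr_eq0; apply/eqP/polyP => i.
have pq0 : basis_combination (p - q) = 0.
  by rewrite linear_B ?pq ?subrr //; apply: basis_combination_linear.
have := e_basis.1 _ (fun i : 'I_(size (p - q)) => (p - q)`_i) pq0.
rewrite coef0; case: (ltnP i (size (p - q))) => [ip /(_ (Ordinal ip))//|].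
by move=> /(nth_default 0)->.
Qed.

Lemma basis_combination_surj v : exists p, basis_combination p = v.
Proof.
have [n [c ->]] := e_basis.2 v.
exists (\poly_(i < n) oapp c 0 (insub i)).
rewrite (basis_combinationE (size_poly _ _)); apply: eq_bigr => i _.
by rewrite coef_poly ltn_ord valK.
Qed.

Lemma scalar_separation v : (forall phi : V -> F, scalar phi -> phi v = 0) ->
  v = 0.
Proof.
move=> v0; have [h hK] := choice basis_combination_surj.
have bL := basis_combination_linear.
have hL k u w : h (k *: u + w) = k *: h u + h w.
  by apply: basis_combination_inj; rewrite bL !hK.
rewrite -(hK v) (_ : h v = 0) ?linear_0 //; apply/polyP => i; rewrite coef0.
by apply: (v0 (fun v => (h v)`_i)) => k u w; rewrite hL coefD coefZ.
Qed.

End CountableBasis.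

Lemma span_finite (F : finFieldType) (V : lmodType F) (s : seq V) :
  exists t : seq V, forall v, in_span s v -> v \in t.
Proof.
elim: s => [|a s [t tP]]; first by exists [:: 0] => v /= ->; rewrite mem_head.
exists [seq b + k *: a | k <- enum F, b <- t] => v [k /tP tv].
by apply/allpairsP; exists (k, v - k *: a); rewrite mem_enum subrK.
Qed.

(** Over a finite field a finite span is a finite set, while the basis vectors are pairwise
    distinct. *)
Lemma countable_basis_infinite_dim (F : finFieldType) (V : lmodType F) :
  countably_infinite_dimensional V -> infinite_dim V.
Proof.
move=> [e eB] s; apply: contrapT => sV; have [t tP] := span_finite s.
have: (size (map e (iota 0 (size t).+1)) <= size t)%N.
  apply: uniq_leq_size.
    by rewrite (map_inj_uniq (basis_inj eB)) iota_uniq.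
  by move=> v _; apply: tP; apply: contrapT => sv; apply: sV; exists v.
by rewrite size_map size_iota ltnn.
Qed.

Section GeneralLinearGroup.
Variables (F : fieldType) (V : lmodType F).
Hypotheses (V_inf : infinite_dim V)
  (V_sep : forall v, (forall phi : V -> F, scalar phi -> phi v = 0) -> v = 0).

Lemma transvection_exists (phi : V -> F) w : scalar phi -> phi w = 0 ->
  exists h : GL V, forall v, h v = v + phi v *: w.
Proof.
move=> phiL phiw; pose h v := v + phi v *: w.
have hP : `[< linear h /\ bijective h >].
  apply/asboolP; split.
    move=> k u v; rewrite /h phiL scalerDl -scalerA addrACA.
    by rewrite -scalerDr.
  exists (fun v => v - phi v *: w) => v; rewrite /h.
    by rewrite scalar_D // scalar_Z // phiw mulr0 addr0 addrK.
  by rewrite scalar_B // scalar_Z // phiw mulr0 subr0 subrK.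
by exists (MkGL hP).
Qed.

(** Commuting with finite-rank maps also requires control of the dual action, hence the functionals;
    nonlinear entries of the list impose nothing. *)
Definition GL_fixes (k : seq V * seq (V -> F)) (g : GL V) :=
  (forall u, u \in k.1 -> g u = u) /\
  (forall phi, phi \in k.2 -> scalar phi -> forall v, phi (g v) = phi v).

Lemma GL_no_nonsingular_mixed_identity :
  ~ admits_nonsingular_mixed_identity (GL V).
Proof.
have GL_invE (g : GL V) v : g (g^-1%g v) = v by apply: (GL_invK g).2.
have GL_invE' (g : GL V) v : g^-1%g (g v) = v by apply: (GL_invK g).1.
apply: (@no_nonsingular_mixed_identity F V (GL V) (@GL_fun F V) (@GL_linear F V)
  _ _ _ ([::], [::]) GL_fixes fst) => //.
- move=> k g h [gU gP] [hU hP]; split=> [u Uu | phi Pphi phiL v].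
    by rewrite GL_mulE hU // gU.
  by rewrite GL_mulE gP // hP.
- move=> k g [gU gP]; split=> [u Uu | phi Pphi phiL v].
    by rewrite -{1}(gU u Uu) GL_invE'.
  by rewrite -(gP phi) // GL_invE.
- move=> k1 k2; exists (k1.1 ++ k2.1, k1.2 ++ k2.2) => g [gU gP].
  split; split=> [u Uu | phi Pphi].
  + by rewrite gU //= mem_cat Uu.
  + by apply: gP; rewrite mem_cat Pphi.
  + by rewrite gU //= mem_cat Uu orbT.
  + by apply: gP; rewrite mem_cat Pphi orbT.
- by move=> k g u [gU _] /gU.
- move=> n [k [s ns]].
  have [|Psi [PsiL Psi0]] := span_norming (L := fun phi : V -> F => scalar phi)
    (fun _ => id) _ V_sep s.
    move=> k' phi psi pL qL a u v.
    by rewrite pL qL !mulrDr addrACA mulrCA.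
  exists (s, [seq (fun v => psi (n v - k *: v)) | psi <- Psi]) => g [gs gPsi].
  apply: GL_ext; apply: (commute_finitary (GL_linear g) ns gs PsiL Psi0).
  move=> psi v Ppsi; apply: (gPsi (fun v => psi (n v - k *: v))).
    exact: map_f.
  move=> a u w; rewrite GL_linear -(PsiL _ Ppsi) scalerDr opprD addrACA.
  by rewrite scalerA mulrC -scalerA -scalerBr.
move=> k s y /(span_separation (L := fun phi : V -> F => scalar phi)
  (fun _ => id)) [||phi [phiL phi0 phiy]] //.
  move=> k' phi psi pL qL a u v.
  by rewrite pL qL !mulrDr addrACA mulrCA.
(* A displacement killed by [phi] defines a transvection; one killed by the functionals of [k.2]
   makes it preserve them. *)
pose Phi := phi :: [seq psi <- k.2 | `[< scalar psi >]].
have PhiL psi : psi \in Phi -> scalar psi.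
  by rewrite inE mem_filter => /orP[/eqP-> | /andP[/asboolP]].
exists (fun w => forall psi, psi \in Phi -> psi w = 0); split.
- by move=> psi /PhiL/scalar_0.
- move=> w1 w2 t w1P w2P; have [x xP tx] := common_kernel_avoid t V_inf PhiL.
  exists x; split=> // psi Ppsi; rewrite scalar_D ?xP ?addr0; auto.
- move=> P sP PhiP; have [t tP] := common_kernel_cofinite PhiL.
  by exists t => v; have [x /PhiP Px tx] := tP v; exists x.
move=> w wP; have [|h hE] := transvection_exists (w := w) phiL.
  by apply: wP; rewrite mem_head.
exists h; split; last by rewrite hE phiy scale1r.
  split=> [u Uu | psi Ppsi psiL v]; rewrite hE.
    by rewrite phi0 ?mem_cat ?Uu // scale0r addr0.
  rewrite scalar_D // scalar_Z // wP ?mulr0 ?addr0 // inE mem_filter Ppsi.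
  by rewrite andbT orbC; move/asboolP: psiL => ->.
by move=> a sa; rewrite hE phi0 ?mem_cat ?sa ?orbT // scale0r addr0.
Qed.

End GeneralLinearGroup.

(** * Isometry groups *)

Section IsometryGroup.
Variables (F : finFieldType) (V : lmodType F) (f : {biscalar V}) (eps : F).
Hypotheses (V_inf : infinite_dim V) (f_nondeg : form_nondegenerate f)
  (eps1 : eps = 1 \/ eps = -1) (fC : forall u v, f u v = eps * f v u).
Implicit Types (A C s t : seq V) (a u v w x y : V).

Definition orthogonal A v := forall a, a \in A -> f a v = 0.

Lemma form_scalar u : scalar (f u).
Proof. by move=> k v w; rewrite linearPr. Qed.

Lemma form_sym0 u v : f u v = 0 -> f v u = 0.
Proof. by move=> uv; rewrite fC uv mulr0. Qed.

Lemma orthogonal_sub A C v : {subset A <= C} -> orthogonal C v ->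
  orthogonal A v.
Proof. by move=> AC Cv a /AC/Cv. Qed.

Lemma orthogonalD A u v : orthogonal A u -> orthogonal A v ->
  orthogonal A (u + v).
Proof. by move=> Au Av a Aa; rewrite linearDr Au // Av // addr0. Qed.

(** An isometry fixing [u] preserves [f u], so here lists of vectors are sufficient data. *)
Definition form_functional (phi : V -> F) := exists u, phi =1 f u.

Lemma form_functional_scalar phi : form_functional phi -> scalar phi.
Proof. by move=> [u phiu] k v w; rewrite !phiu linearPr. Qed.

Lemma form_functional_comb k phi psi :
  form_functional phi -> form_functional psi ->
  form_functional (fun v => k * phi v + psi v).
Proof.
move=> [u phiu] [w psiw]; exists (k *: u + w) => v.
by rewrite phiu psiw linearPl.
Qed.

Lemma form_functional_sep v :
  (forall phi, form_functional phi -> phi v = 0) -> v = 0.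
Proof.
move=> v0; apply: f_nondeg => u; apply: form_sym0.
by apply: (v0 (f u)); exists u.
Qed.

Lemma orthogonal_separation A y : ~ in_span A y ->
  exists2 u, orthogonal A u & f u y = 1.
Proof.
move=> /(span_separation form_functional_scalar form_functional_comb
  form_functional_sep)[phi [[u phiu] phiA phiy]].
exists u; last by rewrite -phiu.
by move=> a Aa; apply: form_sym0; rewrite -phiu phiA.
Qed.

(* U0 collects, for each of the finitely many norms that can be avoided, a
   finite set whose orthogonal complement avoids it. *)
Lemma persistent_norms : exists U0, forall v, orthogonal U0 v ->
  forall C, exists2 t, orthogonal C t & f t t = f v v.
Proof.
pose missed b A := forall v, orthogonal A v -> f v v <> b.
have /choice[W WP] : forall b, exists W, (exists A, missed b A) -> missed b W.
  move=> b.
  have [[A bA] | no] := pselect (exists A, missed b A); first by exists A.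
  by exists [::] => /no.
(* If the complement of [C] avoided the norm of [v], so would that of [W (f v v)], which contains
   [v]. *)
exists (flatten [seq W b | b <- enum F]) => v Uv C; apply: contrapT => no.
suff: missed (f v v) (W (f v v)).
  apply; last by []; apply: orthogonal_sub Uv => a Wa.
  by apply/flattenP; exists (W (f v v)) => //; apply/map_f; rewrite mem_enum.
by apply: WP; exists C => t Ct ft; apply: no; exists t.
Qed.

(** * Isotropic vectors in orthogonal complements *)

Section Core.
Variable U0 : seq V.
Hypothesis U0_persistent : forall v, orthogonal U0 v ->
  forall C, exists2 t, orthogonal C t & f t t = f v v.

Lemma multiple_norm v C n : orthogonal U0 v ->
  exists2 t, orthogonal C t & f t t = f v v *+ n.
Proof.
move=> U0v; elim: n => [|n [t Ct ft]].
  by exists 0; rewrite ?linear0r // => a _; rewrite linear0r.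
have [x Cx fx] := U0_persistent U0v (t :: C).
have tx : f t x = 0 by apply: Cx; rewrite mem_head.
exists (x + t).
  apply: orthogonalD => //; apply: orthogonal_sub Cx => a Ca.
  by rewrite inE Ca orbT.
by rewrite linearDl !linearDr /= tx (form_sym0 tx) fx ft addr0 add0r mulrS.
Qed.

Lemma opposite_norm v C : orthogonal U0 v ->
  exists2 t, orthogonal C t & f t t = - f v v.
Proof.
move=> U0v; have [p p_pr pF] := finPcharP F.
have [t Ct ft] := multiple_norm C p.-1 U0v; exists t => //.
apply/eqP; rewrite -addr_eq0 ft -mulrSr prednK ?prime_gt0 //.
by rewrite mulrn_pchar.
Qed.

(** A separating vector [u] is made isotropic by adding [t] of opposite norm orthogonal to [u], [y]
    and [A]. *)
Lemma isotropic_separation A y : {subset U0 <= A} -> ~ in_span A y ->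
  exists u, [/\ orthogonal A u, f u u = 0 & f u y = 1].
Proof.
move=> U0A /orthogonal_separation[u Au uy].
have [t At ft] := opposite_norm (u :: y :: A) (orthogonal_sub U0A Au).
have ut : f u t = 0 by apply: At; rewrite mem_head.
have ty : f t y = 0 by apply/form_sym0/At; rewrite !inE eqxx orbT.
exists (u + t); split.
- apply: orthogonalD => //; apply: orthogonal_sub At => a Aa.
  by rewrite !inE Aa !orbT.
- by rewrite linearDl !linearDr /= ut (form_sym0 ut) ft addr0 add0r subrr.
by rewrite linearDl /= uy ty addr0.
Qed.

(** For [b] orthogonal to [s] and outside the span of [A], an isotropic [u] pairing to 1 with [b]
    cannot lie in the span of [s]. *)
Lemma isotropic_avoid A s : {subset U0 <= A} ->
  exists u, [/\ orthogonal A u, f u u = 0 & ~ in_span s u].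
Proof.
move=> U0A; have [|b sb Ab] := @common_kernel_avoid _ _
  [seq (f a : V -> F) | a <- s] A V_inf.
  by move=> _ /mapP[a _ ->]; apply: form_scalar.
have [u [Au uu ub]] := isotropic_separation U0A Ab.
exists u; split=> // su; have: f b u = 0.
  apply: span_kills (form_scalar b) _ su => a sa.
  by apply/form_sym0/(sb (f a)); apply: map_f.
by move/form_sym0/eqP; rewrite ub oner_eq0.
Qed.

(** Vectors [v1] and [v2] of equal norm differ by [(v1 + T) - (v2 + T)], where [T] has opposite norm
    and is orthogonal to both, so both terms are isotropic. One representative for each of the
    finitely many norms is added to [t]. *)
Lemma isotropic_span_cofinite A (P : V -> Prop) : {subset U0 <= A} ->
    subspace P -> (forall w, orthogonal A w -> f w w = 0 -> P w) ->
  exists t, forall v, exists2 x, P x & in_span t (v - x).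
Proof.
move=> U0A sP PA.
have [|t tP] := @common_kernel_cofinite _ _ [seq (f a : V -> F) | a <- A].
  by move=> _ /mapP[a _ ->]; apply: form_scalar.
pose has_norm b v := orthogonal A v /\ f v v = b.
have /choice[rep repP] : forall b, exists x, (exists v, has_norm b v) ->
    has_norm b x.
  move=> b; have [[v bv] | no] := pselect (exists v, has_norm b v).
    by exists v.
  by exists 0 => /no.
exists (t ++ map rep (enum F)) => v; have [v1 v1P tv] := tP v.
have Av1 : orthogonal A v1 by move=> a Aa; apply: (v1P (f a)); apply: map_f.
have [|Av2 fv2] := repP (f v1 v1); first by exists v1.
set v2 := rep _ in Av2 fv2; exists (v1 - v2).
  have [T AT fT] := opposite_norm (v1 :: v2 :: A) (orthogonal_sub U0A Av1).
  have AT' : orthogonal A T.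
    by apply: orthogonal_sub AT => a Aa; rewrite !inE Aa !orbT.
  have v1T : f v1 T = 0 by apply: AT; rewrite mem_head.
  have v2T : f v2 T = 0 by apply: AT; rewrite !inE eqxx orbT.
  rewrite -(addrKA T) [T + v2]addrC.
  apply: subspaceB => //; apply: PA; try exact: orthogonalD.
    by rewrite linearDl !linearDr /= v1T (form_sym0 v1T) fT addr0 add0r subrr.
  by rewrite linearDl !linearDr /= v2T (form_sym0 v2T) fT fv2 addr0 add0r subrr.
rewrite opprB addrCA addrC; apply: subspaceD; first exact: span_subspace.
  by apply: span_sub tv => a ta; rewrite mem_cat ta.
by apply/span_mem; rewrite mem_cat map_f ?orbT // mem_enum.
Qed.

End Core.

(** This is an Eichler transformation, without quadratic term as [w] is isotropic. It preserves
    [f u] and [f w], so changing both signs inverts it. *)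
Lemma eichler_isometry u w : f u u = 0 -> f w w = 0 -> f u w = 0 ->
  exists h : isometry_group f,
    forall v, (val h : GL V) v = v + f u v *: w - (eps * f w v) *: u.
Proof.
move=> uu ww uw; have wu := form_sym0 uw.
pose h v := v + f u v *: w - (eps * f w v) *: u.
have hL : linear h.
  move=> k v x; rewrite /h !linearPr /= mulrDr mulrCA !scalerDl -!scalerA.
  rewrite scalerBr scalerDr [RHS]addrACA -opprD; congr (_ - _).
  exact: addrACA.
have uh v : f u (h v) = f u v.
  by rewrite /h linearBr linearDr !linearZr_LR /= uu uw !mulr0 subr0 addr0.
have wh v : f w (h v) = f w v.
  by rewrite /h linearBr linearDr !linearZr_LR /= ww wu !mulr0 subr0 addr0.
pose h' v := v - f u v *: w + (eps * f w v) *: u.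
have uh' v : f u (h' v) = f u v.
  by rewrite /h' linearDr linearBr !linearZr_LR /= uu uw !mulr0 subr0 addr0.
have wh' v : f w (h' v) = f w v.
  by rewrite /h' linearDr linearBr !linearZr_LR /= ww wu !mulr0 subr0 addr0.
have hbij : bijective h.
  exists h' => v; first by rewrite {1}/h' uh wh /h addrAC subrK addrK.
  by rewrite {1}/h uh' wh' /h' addrAC addrK subrK.
have hP : `[< linear h /\ bijective h >] by apply/asboolP.
have hf : preserves_form f (MkGL hP).
  apply/asboolP => v x; change (f (h v) (h x) = f v x).
  rewrite {1}/h linearBl linearDl !linearZl_LR /= uh wh /h.
  rewrite linearBr linearDr !linearZr_LR /=.
  rewrite (fC v w) (fC v u); case: eps1 => ->; ring.
by exists (exist _ (MkGL hP) hf).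
Qed.

Lemma isometry_no_nonsingular_mixed_identity :
  ~ admits_nonsingular_mixed_identity (isometry_group f).
Proof.
pose act (g : isometry_group f) (v : V) := (val g : GL V) v.
have act_linear g : linear (act g) by apply: GL_linear.
have act1 v : act 1%g v = v by [].
have actM g h v : act (g * h)%g v = act g (act h v) by [].
have actf g u v : f (act g u) (act g v) = f u v.
  by have /asboolP := valP g; apply.
have actK g v : act g^-1%g (act g v) = v by rewrite -actM mulVg act1.
have actKV g v : act g (act g^-1%g v) = v by rewrite -actM mulgV act1.
have [U0 U0P] := persistent_norms.
pose fixes k (g : isometry_group f) :=
  forall u, u \in U0 ++ k -> act g u = u.
apply: (@no_nonsingular_mixed_identity F V (isometry_group f) act act_linear
  act1 actM _ [::] fixes (fun k => U0 ++ k)) => //.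
- by move=> k g h gk hk u ku; rewrite actM hk // gk.
- by move=> k g gk u ku; rewrite -{1}(gk u ku) actK.
- move=> k1 k2; exists (k1 ++ k2) => g gk.
  by split=> u; rewrite mem_cat => /orP[] ku; apply: gk;
    rewrite !mem_cat ku ?orbT.
- by move=> k g u; apply.
- move=> n [k [s ns]].
  have [Psi [PsiL Psi0]] := span_norming form_functional_scalar
    form_functional_comb form_functional_sep s.
  have /choice[vec vecP] : forall psi, exists u,
      form_functional psi -> psi =1 f u.
    move=> psi; have [[u psiu] | no] := pselect (form_functional psi).
      by exists u.
    by exists 0 => /no.
  (* The adjoint of [n - k], as the adjoint of an isometry is its inverse. Fixing [adj u] preserves
     the functional [f u] composed with [n - k]. *)
  pose adj u := act n^-1%g u - k *: u.
  have adjE u v : f u (act n v - k *: v) = f (adj u) v.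
    rewrite /adj linearBr linearBl linearZr_LR linearZl_LR /=.
    by rewrite -(actf n (act n^-1%g u)) actKV.
  exists (s ++ [seq adj (vec psi) | psi <- Psi]) => g gs.
  apply/val_inj/GL_ext => v; change (act g (act n v) = act n (act g v)).
  apply: (commute_finitary (act_linear g) ns _ _ Psi0).
  + by move=> a sa; apply: gs; rewrite !mem_cat sa orbT.
  + by move=> psi /PsiL/form_functional_scalar.
  move=> psi x Ppsi; rewrite !(vecP _ (PsiL _ Ppsi)) !adjE.
  rewrite -[in LHS](gs (adj _)) ?actf // !mem_cat orbA orbC.
  by rewrite (map_f (fun psi => adj (vec psi))).
move=> k s y Ay; set A := (U0 ++ k) ++ s in Ay.
have U0A : {subset U0 <= A} by move=> a U0a; rewrite !mem_cat U0a.
have [u [Au uu uy]] := isotropic_separation U0P U0A Ay.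
(* Orthogonality to [u] is required by the Eichler transformation; orthogonality to [y], with
   [f u y = 1], makes it send [y] to exactly [y + w]. *)
pose C := u :: y :: A.
have AC : {subset A <= C} by move=> a Aa; rewrite !inE Aa !orbT.
have U0C : {subset U0 <= C} by move=> a /U0A/AC.
exists (fun w => orthogonal C w /\ f w w = 0); split.
- by split=> [a _|]; rewrite linear0r.
- move=> w1 w2 t [Cw1 ww1] [Cw2 ww2].
  have [|x [Cx xx tx]] := isotropic_avoid U0P (A := w1 :: w2 :: C) t.
    by move=> a U0a; rewrite 2!in_cons U0C ?orbT.
  have Cx' : orthogonal C x.
    by apply: orthogonal_sub Cx => a Ca; rewrite 2!in_cons Ca !orbT.
  have wx w : f w w = 0 -> w \in [:: w1; w2] -> f (w + x) (w + x) = 0.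
    move=> ww w12; have wx0 : f w x = 0.
      by apply: Cx; move: w12; rewrite !inE => /orP[]->; rewrite ?orbT.
    by rewrite linearDl !linearDr /= ww xx wx0 (form_sym0 wx0) !addr0.
  exists x; split=> //; split; try exact: orthogonalD.
    by apply: wx => //; rewrite mem_head.
  by apply: wx => //; rewrite !inE eqxx orbT.
- by move=> P sP PQ; apply: (isotropic_span_cofinite U0P U0C sP); auto.
move=> w [Cw ww]; have uw : f u w = 0 by apply: Cw; rewrite mem_head.
have [h hE] := eichler_isometry uu ww uw.
have hA a : a \in A -> act h a = a.
  move=> Aa; rewrite /act hE (form_sym0 (Au _ Aa)).
  by rewrite (form_sym0 (Cw _ (AC _ Aa))) mulr0 !scale0r addr0 subr0.
exists h; split.
- by move=> a ka; apply: hA; rewrite mem_cat ka.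
- by move=> a sa; apply: hA; rewrite mem_cat sa orbT.
rewrite /act hE uy scale1r (form_sym0 (Cw y _)) ?mulr0 ?scale0r ?subr0 //.
by rewrite !inE eqxx orbT.
Qed.

End IsometryGroup.

Theorem corollary3p3p3 (F : finFieldType) (V : lmodType F)
    (V_dim : countably_infinite_dimensional V) :
  [/\ ~ admits_nonsingular_mixed_identity (GL V),
      forall f : {biscalar V}, form_symmetric f -> form_nondegenerate f ->
        ~ admits_nonsingular_mixed_identity (isometry_group f)
    & forall f : {biscalar V}, form_alternating f -> form_nondegenerate f ->
        ~ admits_nonsingular_mixed_identity (isometry_group f)].
Proof.
have V_inf := countable_basis_infinite_dim V_dim.
split=> [|f f_sym f_nondeg|f f_alt f_nondeg].
- have [e e_basis] := V_dim.
  exact: GL_no_nonsingular_mixed_identity V_inf (scalar_separation e_basis).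
- apply: (isometry_no_nonsingular_mixed_identity V_inf f_nondeg (eps := 1)).
    by left.
  by move=> u v; rewrite mul1r.
apply: (isometry_no_nonsingular_mixed_identity V_inf f_nondeg (eps := -1)).
  by right.
move=> u v; apply/eqP; rewrite mulN1r -addr_eq0; apply/eqP.
have := f_alt (u + v).
by rewrite linearDl !linearDr /= !f_alt add0r addr0.
Qed.
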